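(* Let $H$ be a balanced, uniformable, matching covered hypergraph and let $S\subseteq V(H)$ be such that $\delta_H(S)$ is a tight cut. Then the two tight cut contractions $H_S$ and $H_{\overline S}$ are balanced.
   Context: A hypergraph $H$ has a finite vertex set $V(H)$ and a finite family $E(H)$ of non-empty subsets of $V(H)$, called edges; parallel edges (distinct members with the same vertices) are allowed. A perfect matching of $H$ is a set $M$ of edges such that every vertex of $H$ lies in exactly one edge of $M$. $H$ is matching covered if it is connected, $|E(H)|\geq 1$, and every edge lies in a perfect matching. $H$ is uniformable if there are $m:V(H)\to\mathbb{Z}_{\geq 1}$ and $r\in\mathbb{Z}$ with $\sum_{v\in e}m(v)=r$ for all $e\in E(H)$. A cycle of length $t\ge 2$ in $H$ is a sequence $x_1e_1x_2\ldots x_te_tx_1$ of pairwise distinct vertices $x_i$ and pairwise distinct edges $e_i$ with $x_i,x_{i+1}\in e_i$ for all $i\in\{1,\ldots,t\}$, where $x_{t+1}=x_1$. It is strong if the only vertices among $x_1,\ldots,x_t$ contained in $e_i$ are $x_i$ and $x_{i+1}$, for every $i$. $H$ is balanced if it contains no strong cycle of odd length. For $S\subseteq V(H)$ put $\overline{S}=V(H)\setminus S$, and let $\delta_H(S)$ be the family of edges meeting both $S$ and $\overline S$. The cut $\delta_H(S)$ is tight if $|M\cap\delta_H(S)|=1$ for every perfect matching $M$ of $H$. Tight cut contractions: let $s,\overline s\notin V(H)$ be new vertices. For $e\in\delta_H(S)$ put $e_s=(e\setminus S)\cup\{s\}$ and $e_{\overline s}=(e\cap S)\cup\{\overline s\}$.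 Then $H_S$ has vertex set $\{s\}\cup\overline S$ and edges $\{e\in E(H): e\subseteq\overline S\}\cup\{e_s:e\in\delta_H(S)\}$, and $H_{\overline S}$ has vertex set $\{\overline s\}\cup S$ and edges $\{e\in E(H):e\subseteq S\}\cup\{e_{\overline s}:e\in\delta_H(S)\}$ (each $e\in\delta_H(S)$ gives its own edge). *)

(* Defs.v *)
From mathcomp Require Import all_boot all_order all_algebra.

Set Implicit Arguments.
Unset Strict Implicit.
Unset Printing Implicit Defensive.

Import Order.TTheory GRing.Theory Num.Theory.

(* Edges are indexed by a finite type, so that distinct edges may have the
   same vertex set (parallel edges). *)
Record hypergraph := Hypergraph {
  vertex : finType;
  hedge : finType;
  vset : hedge -> {set vertex};
  vset_neq0 : forall e, vset e != set0
}.

Definition adjacent (H : hypergraph) : rel (vertex H) :=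
  [rel u v | [exists e : hedge H, (u \in vset e) && (v \in vset e)]].

Definition connected (H : hypergraph) : Prop :=
  forall u v : vertex H, connect (@adjacent H) u v.

Definition perfect_matching (H : hypergraph) (M : {set hedge H}) : Prop :=
  forall v : vertex H, #|[set e in M | v \in vset e]| = 1.

Definition matching_covered (H : hypergraph) : Prop :=
  [/\ connected H,
      1 <= #|hedge H|
    & forall e : hedge H, exists2 M : {set hedge H},
        perfect_matching M & e \in M].

Definition uniformable (H : hypergraph) : Prop :=
  exists (m : vertex H -> int) (r : int),
    (forall v, (1 <= m v)%R) /\
    (forall e : hedge H, (\sum_(v in vset e) m v)%R = r).

(* Indices live in 'I_t and [ordS] is the cyclic successor, so that
   x_{t+1} = x_1. *)
Definition is_cycle (H : hypergraph) (t : nat)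
    (x : 'I_t -> vertex H) (e : 'I_t -> hedge H) : Prop :=
  [/\ 2 <= t, injective x, injective e
    & forall i, x i \in vset (e i) /\ x (ordS i) \in vset (e i)].

Definition is_strong_cycle (H : hypergraph) (t : nat)
    (x : 'I_t -> vertex H) (e : 'I_t -> hedge H) : Prop :=
  is_cycle x e /\
  forall i j, x j \in vset (e i) -> x j = x i \/ x j = x (ordS i).

Definition balanced (H : hypergraph) : Prop :=
  ~ exists (t : nat) (x : 'I_t -> vertex H) (e : 'I_t -> hedge H),
      is_strong_cycle x e /\ odd t.

Definition cut (H : hypergraph) (S : {set vertex H}) : {set hedge H} :=
  [set e | (vset e :&: S != set0) && (vset e :&: ~: S != set0)].

Definition tight_cut (H : hypergraph) (S : {set vertex H}) : Prop :=
  forall M : {set hedge H}, perfect_matching M -> #|M :&: cut S| = 1.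

Section Contraction.

Variables (H : hypergraph) (S : {set vertex H}).

(* [None] is the new vertex s. *)
Definition contr_vertex : finType := option {v : vertex H | v \notin S}.

Definition contr_hedge : finType :=
  {e : hedge H | (vset e \subset ~: S) || (e \in cut S)}.

Definition contr_vset (e : contr_hedge) : {set contr_vertex} :=
  [set w : contr_vertex |
    if w is Some v then val v \in vset (val e) else val e \in cut S].

Lemma contr_vset_neq0 (e : contr_hedge) : contr_vset e != set0.
Proof.
case: (boolP (val e \in cut S)) => [eS | eNS].
  by apply/set0Pn; exists None; rewrite inE.
have /orP[/subsetP sub|] := valP e; last by rewrite (negbTE eNS).
have /set0Pn[v ve] := vset_neq0 (val e).
have vS : v \notin S by rewrite -in_setC sub.
by apply/set0Pn; exists (Some (exist _ v vS)); rewrite inE.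
Qed.

(* This is H_S: S is shrunk to a single vertex. The other contraction
   H_{\overline S} is [contraction (~: S)]. *)
Definition contraction : hypergraph := Hypergraph contr_vset_neq0.

End Contraction.

(* Main.v *)
Require Import Defs.
From mathcomp Require Import all_boot all_order all_algebra.
From mathcomp Require Import zify.

Set Implicit Arguments.
Unset Strict Implicit.
Unset Printing Implicit Defensive.

Import Order.TTheory GRing.Theory Num.Theory.

(** An odd strong cycle of [H_S] avoiding the new vertex [s] is already one of
    [H]. Otherwise it enters and leaves [s] by two cut edges [f] and [g]; take
    perfect matchings [M] containing [f] and [N] containing [g]. Two members of
    [M] and [N] sharing a vertex of [S] are joined by a step of an alternating
    path, and a path from [g] to [f] inside [S] has an odd number of steps, so
    substituting it for [s] keeps the length of the cycle odd; the result is
    strong because each vertex is in one edge of [M] and one of [N]. Such a path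
    exists: otherwise the component of [f] would cover the same part of [S] by
    [M] and by [N], and weighing this part modulo [r] would make the weight of
    [f] in [S] divisible by [r], although it lies strictly between [0] and
    [r]. *)

(** * Strong cycles as circulant incidence patterns *)

(* Edge [i] follows vertex [i.-1] and precedes vertex [i], a shift with respect
   to [is_cycle]. For [t > 2], incidence alone forces distinctness. *)
Definition circulant (H : hypergraph) (t : nat)
    (x : nat -> vertex H) (e : nat -> hedge H) : Prop :=
  forall i j, i < t -> j < t ->
    (x j \in vset (e i)) = (i == j) || (i == j.+1 %% t).

Lemma ordSS_neq t (i : 'I_t) : 2 < t -> ordS (ordS i) != i.
Proof.
move=> t2; apply/eqP => /(congr1 val) /= ii; have it := ltn_ord i.
rewrite -addn1 modnDml addn1 in ii.
have [lt|ge] := ltnP i.+2 t; first by rewrite modn_small in ii => //; lia.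
have E : i.+2 = t + (i.+2 - t) by lia.
by rewrite E modnDl modn_small in ii; lia.
Qed.

(** Equal vertices or edges at distinct indices would make each index the cyclic successor of the
    other, which [ordSS_neq] excludes. *)
Lemma balanced_no_circulant (H : hypergraph) t x e :
  balanced H -> odd t -> 2 < t -> @circulant H t x e -> False.
Proof.
move=> bal oddt t2 circ; apply: bal.
have inc (i j : 'I_t) :
    (x j \in vset (e (ordS i))) = (ordS i == j) || (i == j).
  by rewrite circ // -[RHS]/((ordS i == j :> nat) || (i == j))
    -(inj_eq (@ordS_inj t)).
have t1 : 1 < t by apply: ltnW.
exists t, (fun i : 'I_t => x i), (fun i : 'I_t => e (ordS i)).
split=> //; split; first split=> //.
- move=> i j xij; apply/eqP.
  have := inc i i; rewrite eqxx orbT xij inc => /orP[/eqP|] // Sij.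
  have := inc j j; rewrite eqxx orbT -xij inc => /orP[/eqP|/eqP->] // Sji.
  by have := ordSS_neq i t2; rewrite Sij Sji eqxx.
- move=> i j eij; apply/eqP.
  have := inc i i; rewrite eqxx orbT eij inc => /orP[/eqP|/eqP->] // Sji.
  have := inc j j; rewrite eqxx orbT -eij inc => /orP[/eqP|] // Sij.
  by have := ordSS_neq i t2; rewrite Sij Sji eqxx.
- by move=> i; rewrite !inc !eqxx orbT.
by move=> i j; rewrite inc => /orP[] /eqP ->; [right|left].
Qed.

(** The cycle is rotated to put [x i0] last; when this is the new vertex, its two edges get the
    extreme indices. *)
Lemma strong_cycle_circulant (H : hypergraph) t x e (i0 : 'I_t) :
  @is_strong_cycle H t x e ->
  exists X E, [/\ X t.-1 = x i0, forall j, exists i, X j = x i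
    & @circulant H t X E].
Proof.
move=> [[t2 injx inje inc] strong].
pose rt i := iter i (@ordS t) i0.
have rtE i : rt i = (i0 + i) %% t :> nat.
  elim: i => [|i IH]; first by rewrite addn0 modn_small.
  by rewrite /rt iterS /= -/(rt i) IH -addn1 modnDml addn1 addnS.
have rt_inj i j : i < t -> j < t -> rt i = rt j -> i = j.
  move=> it jt /(congr1 val); rewrite /= !rtE => /eqP.
  by rewrite eqn_modDl !modn_small // => /eqP.
have rtt : rt t = i0.
  by apply: val_inj; rewrite /= rtE modnDr modn_small.
have rt_mod j : j < t -> rt (j.+1 %% t) = rt j.+1.
  by move=> jt; apply: ord_inj; rewrite !rtE modnDmr.
exists (fun i => x (rt i.+1)), (fun i => e (rt i)).
split=> [|j|]; first by rewrite prednK ?rtt //; lia.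
  by exists (rt j.+1).
move=> i j it jt; have t0 : 0 < t by lia.
apply/idP/orP => [/strong [] /injx|[] /eqP ->].
- by rewrite -rt_mod // => /rt_inj <-; rewrite ?ltn_mod //; right.
- by rewrite /rt !iterS => /ordS_inj /rt_inj ->; rewrite ?eqxx //; left.
- by have [] := inc (rt j).
by rewrite rt_mod //; have [] := inc (rt j.+1).
Qed.

(** * Perfect matchings and the weight of edges in [S] *)

Lemma perfect_matching_cover (H : hypergraph) (M : {set hedge H}) v :
  perfect_matching M -> exists2 e, e \in M & v \in vset e.
Proof.
move/(_ v)/eqP/cards1P => [e eP].
by have := set11 e; rewrite -eP inE => /andP[]; exists e.
Qed.

Lemma perfect_matching_uniq (H : hypergraph) (M : {set hedge H}) v e f :
  perfect_matching M -> e \in M -> f \in M -> v \in vset e -> v \in vset f ->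
  e = f.
Proof.
move/(_ v)/eqP/cards1P => [g gP] eM fM ve vf.
have : e \in [set g] by rewrite -gP inE eM.
have : f \in [set g] by rewrite -gP inE fM.
by rewrite !inE => /eqP -> /eqP ->.
Qed.

Lemma notin_cutE (H : hypergraph) (S : {set vertex H}) e :
  (e \notin cut S) = (vset e \subset S) || (vset e \subset ~: S).
Proof.
by rewrite inE negb_and !negbK orbC -setDE setD_eq0 setI_eq0 disjoints_subset.
Qed.

Lemma weight_cut_lt (H : hypergraph) (S : {set vertex H})
    (m : vertex H -> int) r e :
  (forall v, (1 <= m v)%R) -> (\sum_(v in vset e) m v = r)%R -> e \in cut S ->
  (0 < \sum_(v in vset e :&: S) m v < r)%R.
Proof.
move=> m1 <-; rewrite inE => /andP[/set0Pn[u uS] /set0Pn[w wS]].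
have pos (A : {set vertex H}) z : z \in A -> (0 < \sum_(v in A) m v)%R.
  move=> zA; rewrite (bigD1 z) //=; apply: ltr_pwDl.
    by apply: lt_le_trans (m1 z).
  by apply: sumr_ge0 => v _; apply: le_trans (m1 v).
rewrite (pos _ _ uS) /= [ltRHS](big_setID S) /= setDE ltrDl.
exact: pos wS.
Qed.

(** The edges of a perfect matching are pairwise disjoint, so each covered vertex of [S] is counted
    once. *)
Lemma sum_cover (H : hypergraph) (S : {set vertex H}) (m : vertex H -> int)
    (M A : {set hedge H}) :
  perfect_matching M -> A \subset M ->
  (\sum_(e in A) \sum_(v in vset e :&: S) m v =
   \sum_(v in S | [exists e in A, v \in vset e]) m v)%R.
Proof.
move=> pM /subsetP sAM.
rewrite (exchange_big_dep (mem S)) /=; last by move=> e v _ /setIP[].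
rewrite [RHS]big_mkcondr; apply: eq_bigr => v vS.
case: exists_inP => [[e eA ve]|no].
  rewrite (big_pred1 e) // => f /=; rewrite inE vS andbT.
  apply/andP/eqP => [[fA vf]|-> //].
  by apply: perfect_matching_uniq pM _ _ vf ve; apply: sAM.
rewrite big1 // => e /andP[eA]; rewrite inE => /andP[ve _].
by case: no; exists e.
Qed.

(** * Alternating paths through [S] between two cut edges *)

Section AlternatingPath.

Variables (H : hypergraph) (S : {set vertex H}) (M N : {set hedge H}).
Variables (f g : hedge H).
Hypotheses (pM : perfect_matching M) (pN : perfect_matching N).
Hypotheses (Mcut : M :&: cut S = [set f]) (Ncut : N :&: cut S = [set g]).
Hypothesis fg : f != g.

(** Only edges of the symmetric difference are related, so membership in [M] settles membership in
    [N], and each step flips both. *)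
Definition alternating : rel (hedge H) :=
  [rel a b | [&& (a \in M) != (a \in N), (b \in M) != (b \in N),
    (a \in M) != (b \in M) & vset a :&: vset b :&: S != set0]].

Lemma cutP_M e : e \in M -> (e \in cut S) = (e == f).
Proof. by move=> eM; rewrite -in_set1 -Mcut in_setI eM. Qed.

Lemma cutP_N e : e \in N -> (e \in cut S) = (e == g).
Proof. by move=> eN; rewrite -in_set1 -Ncut in_setI eN. Qed.

Lemma f_mem : [/\ f \in M, f \in cut S & f \notin N].
Proof.
have /setIP[fM fc] : f \in M :&: cut S by rewrite Mcut set11.
by split=> //; apply/negP => /cutP_N; rewrite fc (negbTE fg).
Qed.

Lemma g_mem : [/\ g \in N, g \in cut S & g \notin M].
Proof.
have /setIP[gN gc] : g \in N :&: cut S by rewrite Ncut set11.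
by split=> //; apply/negP => /cutP_M; rewrite gc eq_sym (negbTE fg).
Qed.

Lemma alternating_sym : symmetric alternating.
Proof.
move=> a b; rewrite /alternating /= [vset b :&: vset a]setIC [(b \in M) == (a \in M)]eq_sym.
by rewrite andbCA.
Qed.

Lemma connect_alternating_mem a :
  connect alternating f a -> (a \in M) != (a \in N).
Proof.
case/connectP=> p; case: (lastP p) => [_ ->|q b].
  by have [-> _ /negbTE ->] := f_mem.
by rewrite rcons_path last_rcons => /andP[_ /and4P[_ hb _ _]] ->.
Qed.

(** Two distinct edges through [v] cannot lie in the same matching; as [a] lies in exactly one of
    the two, a different [b] lies in exactly the other. *)
Lemma connect_alternating_step a b v :
  connect alternating f a -> v \in S -> v \in vset a -> v \in vset b ->
  (a \in M) && (b \in N) || (a \in N) && (b \in M) ->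
  connect alternating f b.
Proof.
move=> fa vS va vb ab.
have := connect_alternating_mem fa.
have [<- // | ne aD] := eqVneq a b.
apply: connect_trans fa (connect1 _); rewrite /alternating /= aD /=.
have -> : vset a :&: vset b :&: S != set0.
  by apply/set0Pn; exists v; rewrite !inE va vb.
have dM : a \in M -> b \notin M.
  by move=> aM; apply/negP => /(perfect_matching_uniq pM aM) /(_ va vb)/eqP;
     rewrite (negbTE ne).
have dN : a \in N -> b \notin N.
  by move=> aN; apply/negP => /(perfect_matching_uniq pN aN) /(_ va vb)/eqP;
     rewrite (negbTE ne).
move: ab aD dM dN.
by case: (a \in M); case: (a \in N); case: (b \in M); case: (b \in N) => //=
   _ _ dM dN; first [by have := dM isT | by have := dN isT].
Qed.

Lemma alternating_connected : uniformable H -> connect alternating g f.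
Proof.
case=> m [r [m1 mr]]; rewrite (sym_connect_sym alternating_sym).
apply/negPn/negP => ngf.
have [fM fc fN] := f_mem; have [gN gc gM] := g_mem.
pose A := [set e in M | connect alternating f e].
pose B := [set e in N | connect alternating f e].
pose w e : int := (\sum_(v in vset e :&: S) m v)%R.
(* An edge outside the cut weighs [r] if it lies inside [S], and 0 if it avoids [S]. *)
have wdvd e : e \notin cut S -> (r %| w e)%Z.
  rewrite notin_cutE => /orP[/setIidPl|].
    by rewrite /w => ->; rewrite mr dvdzz.
  rewrite -disjoints_subset -setI_eq0 => /eqP e0.
  by rewrite /w e0 big_set0 dvdz0.
have AB : (\sum_(e in A) w e = \sum_(e in B) w e)%R.
  rewrite (sum_cover _ _ pM); last by apply/subsetP => e; rewrite inE => /andP[].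
  rewrite (sum_cover _ _ pN); last by apply/subsetP => e; rewrite inE => /andP[].
  apply: eq_bigl => v; case vS: (v \in S) => //=.
  apply/exists_inP/exists_inP => -[e]; rewrite inE => /andP[eM ce] ve.
    have [e' e'N ve'] := perfect_matching_cover v pN.
    exists e' => //; rewrite inE e'N /=.
    by apply: connect_alternating_step ce vS ve ve' _; rewrite eM e'N.
  have [e' e'N ve'] := perfect_matching_cover v pM.
  exists e' => //; rewrite inE e'N /=.
  by apply: connect_alternating_step ce vS ve ve' _; rewrite eM e'N orbT.
(* The only cut edge of [N] is [g], which is outside the component of [f]; the only one in [A] is
   [f]. *)
have dvdB : (r %| (\sum_(e in B) w e)%R)%Z.
  apply: rpred_sum => e; rewrite inE => /andP[eN ce]; apply: wdvd.
  by rewrite cutP_N //; apply: contraNneq ngf => <-.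
have fA : f \in A by rewrite inE fM connect0.
have dvdA : (r %| (\sum_(e in A | e != f) w e)%R)%Z.
  apply: rpred_sum => e /andP[]; rewrite inE => /andP[eM ce] ef; apply: wdvd.
  by rewrite cutP_M.
have : (r %| w f)%Z.
  by move: dvdB; rewrite -AB (bigD1 f) //= rpredDr.
have /andP[w0 wr] : (0 < w f < r)%R := weight_cut_lt m1 (mr f) fc.
have r0 : (0 < r)%R := lt_trans w0 wr.
(* A multiple [q * r] strictly between 0 and [r] would need [0 < q < 1]. *)
case/dvdzP=> q wE; move: w0 wr.
by rewrite wE pmulr_lgt0 // gtr_pMl // => q0; rewrite ltNge -gtz0_ge1 q0.
Qed.

Lemma alternating_path_parity a p :
  path alternating a p -> (last a p \in M) = (a \in M) (+) odd (size p).
Proof.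
elim: p a => [|b p IH] a /=; first by rewrite addbF.
case/andP=> /and4P[_ _ ab _] /IH ->; move: ab.
by case: (a \in M); case: (b \in M); case: (odd _).
Qed.

(** A simple path suffices: [h l] and [h l.+1] are the edges of the two matchings at [z l], so no
    other edge of the path contains it. *)
Lemma alternating_path : uniformable H ->
  exists k (h : nat -> hedge H) (z : nat -> vertex H),
  [/\ odd k, h 0 = g, h k = f, forall i, 0 < i < k -> vset (h i) \subset S
    & forall l, l < k -> z l \in S /\
        forall i, i <= k -> (z l \in vset (h i)) = (i == l) || (i == l.+1)].
Proof.
move=> unif; have [fM fc fN] := f_mem; have [gN gc gM] := g_mem.
have /connectP[q0 gq0 lastq0] := alternating_connected unif.
case/shortenP: gq0 lastq0 => p gp up _ lastp {q0}.
pose h i := nth g (g :: p) i; pose k := size p.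
have /set0Pn[v0 _] := vset_neq0 g.
(* For [l < k] the intersection is nonempty, so the default [v0] is not taken there. *)
pose z l := odflt v0 [pick v in vset (h l) :&: vset (h l.+1) :&: S].
have step l : l < k -> alternating (h l) (h l.+1).
  by move=> lk; apply: (pathP g gp).
have zP l : l < k -> z l \in vset (h l) :&: vset (h l.+1) :&: S.
  move=> /step /and4P[_ _ _ /set0Pn[v vP]]; rewrite /z.
  by case: pickP => [//|/(_ v)]; rewrite vP.
have hk : h k = f by rewrite /h nth_last.
have kodd : odd k.
  by have := alternating_path_parity gp; rewrite -lastp fM (negbTE gM).
have hinj i j : i <= k -> j <= k -> h i = h j -> i = j.
  by move=> ik jk /eqP; rewrite nth_uniq // => /eqP.
have hMN i : i <= k -> (h i \in M) != (h i \in N).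
  rewrite leq_eqVlt => /orP[/eqP ->|/step /and4P[] //].
  by rewrite hk fM (negbTE fN).
exists k, h, z; split=> // [i /andP[i0 ik]|l lk].
  (* The matchings have no cut edges but [f] and [g], which a simple path meets only at its ends. *)
  have ncut : h i \notin cut S.
    have nf : h i != f.
      by apply/eqP; rewrite -hk => /(hinj i k (ltnW ik) (leqnn k)); lia.
    have ng : h i != g.
      by apply/eqP => /(hinj i 0 (ltnW ik) isT); lia.
    have := hMN i (ltnW ik).
    have [iM _|_] := boolP (h i \in M); first by rewrite cutP_M.
    by have [iN _|] := boolP (h i \in N); first by rewrite cutP_N.
  move: ncut; rewrite notin_cutE => /orP[//|/subsetP dis].
  have /setIP[/setIP[zi _] zS] := zP i ik.
  by have := dis _ zi; rewrite inE zS.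
have /setIP[/setIP[zl zl1] zS] := zP l lk; split=> // i ik.
apply/idP/orP => [zi|[] /eqP -> //].
have /and4P[lD l1D ll _] := step l lk.
have l1M : (h l.+1 \in M) = (h l \notin M).
  by move: ll; do 2 case: (_ \in M).
have l1N : (h l.+1 \in N) = (h l \notin N).
  by move: lD l1D ll; do 2 case: (_ \in M); do 2 case: (_ \in N).
(* Exactly one of [h l] and [h l.+1] is in [P], and [h i] shares [z l] with it. *)
have uniq_at (P : {set hedge H}) : perfect_matching P ->
    (h l.+1 \in P) = (h l \notin P) -> h i \in P -> i == l \/ i == l.+1.
  move=> pP l1P iP; have [lP|] := boolP (h l \in P); [left|right].
    by apply/eqP/hinj; rewrite ?(ltnW lk) // (perfect_matching_uniq pP iP lP zi).
  apply/eqP/hinj => //; apply: perfect_matching_uniq pP iP _ zi zl1.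
  by rewrite l1P.
have [iM|iM] := boolP (h i \in M); first exact: uniq_at pM l1M iM.
apply: uniq_at pN l1N _; have := hMN i ik.
by rewrite (negbTE iM); case: (h i \in N).
Qed.

End AlternatingPath.

(** * Expanding the new vertex of a contraction *)

Lemma tight_cut_matching (H : hypergraph) (S : {set vertex H}) e :
  matching_covered H -> tight_cut S -> e \in cut S ->
  exists2 M, perfect_matching M & M :&: cut S = [set e].
Proof.
move=> [_ _ cov] tight ec; have [M pM eM] := cov e; exists M => //.
have /eqP/cards1P[g gP] := tight M pM; rewrite gP.
have : e \in M :&: cut S by rewrite in_setI eM.
by rewrite gP in_set1 => /eqP ->.
Qed.

Lemma mem_contr_Some (H : hypergraph) (S : {set vertex H}) v
    (e : hedge (contraction S)) :
  (Some v \in vset e) = (val v \in vset (val e)).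
Proof. by rewrite inE. Qed.

Lemma mem_contr_None (H : hypergraph) (S : {set vertex H})
    (e : hedge (contraction S)) :
  (None \in vset e) = (val e \in cut S).
Proof. by rewrite inE. Qed.

(** Trades the remainder for linear conditions that [lia] can handle. *)
Lemma eq_modnS t i j : i < t -> j < t ->
  (i == j.+1 %% t) = (i == j.+1) || (i == 0) && (j.+1 == t).
Proof.
move=> it jt; have [->|ne] := eqVneq j.+1 t; first by rewrite modnn; lia.
by rewrite modn_small; lia.
Qed.

(** The vertices of index below [n] are followed by those of the path, which leads from the last
    edge [g] back to the first edge [f]. *)
Lemma contraction_circulant (H : hypergraph) (S : {set vertex H}) t x e :
  balanced H -> uniformable H -> matching_covered H -> tight_cut S ->
  odd t -> 2 < t -> @circulant (contraction S) t x e -> x t.-1 = None -> False.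
Proof.
move=> bal unif cov tight oddt t2 circ xN.
case: t => // n in oddt t2 circ xN *; rewrite /= in oddt xN.
have En i : i < n.+1 -> (val (e i) \in cut S) = (i == n) || (i == 0).
  by move=> it; rewrite -mem_contr_None -xN circ // modnn.
(* A vertex of index [j < n] lies in edges [j] and [j.+1], the new vertex in edges [0] and [n];
   these pairs differ because [n > 1]. *)
have xS j : j < n -> exists v, x j = Some v.
  move=> jn; case xj: (x j) => [v|]; first by exists v.
  have in_e i : i < n.+1 -> (i == j) || (i == j.+1) = (i == n) || (i == 0).
    by move=> it; rewrite -En // -mem_contr_None -xj circ // ?modn_small //; lia.
  have := in_e j.+1; have := in_e j; lia.
pose f := val (e 0); pose g := val (e n).
have fg : f != g.
  apply/eqP => /val_inj e0n; have := circ 0 0 isT isT.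
  by rewrite e0n circ // !modn_small //; lia.
have [M pM Mcut] : exists2 M, perfect_matching M & M :&: cut S = [set f].
  by apply: tight_cut_matching; rewrite // En // eqxx orbT.
have [N pN Ncut] : exists2 N, perfect_matching N & N :&: cut S = [set g].
  by apply: tight_cut_matching; rewrite // En // eqxx.
have [k [h [z [oddk h0 hk hS zP]]]] :=
  alternating_path pM pN Mcut Ncut fg unif.
have /set0Pn[v0 _] := vset_neq0 f.
pose y j := if x j is Some v then val v else v0.
have yS j : j < n -> y j \notin S.
  by rewrite /y => /xS[v ->]; exact: (valP v).
have yE i j : i < n.+1 -> j < n ->
    (y j \in vset (val (e i))) = (i == j) || (i == j.+1).
  move=> it jn; have [v xj] := xS j jn.
  rewrite /y xj -mem_contr_Some -xj circ // ?modn_small //; lia.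
(* Only the two extreme edges are cut edges; the others lie in the complement of [S]. *)
have eS i v : 0 < i < n -> v \in S -> v \notin vset (val (e i)).
  move=> i0n vS; apply/negP => vi; have it : i < n.+1 by lia.
  have /orP[/subsetP/(_ v vi)|] := valP (e i); first by rewrite inE vS.
  by rewrite En //; lia.
(* The path puts [k] vertices in place of the new one and adds [k - 1] edges, since [h 0] and [h k]
   are [g] and [f]; [n] is even and [k] odd. *)
pose T := n + k.
pose X j := if j < n then y j else z (j - n).
pose E i := if i <= n then val (e i) else h (i - n).
apply: (@balanced_no_circulant H T X E) => //.
- by rewrite oddD oddk; case: (odd n) oddt.
- by rewrite /T; case: k oddk {hk hS zP T} => //; lia.
move=> i j iT jT; rewrite eq_modnS // /X /E.
have [jn|jn] := ltnP j n; have [li|li] := leqP i n.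
- by rewrite yE //; lia.
- have /negbTE -> : y j \notin vset (h (i - n)).
    by apply: contra (yS j jn); apply/subsetP/hS; lia.
  by lia.
- have [zS zh] : _ := zP (j - n) ltac:(lia).
  have [i0|i0] := posnP i.
    by rewrite i0 -/f -hk zh //; lia.
  have [lin|lin] := ltnP i n.
    by rewrite (negbTE (eS _ _ _ zS)) ?i0 //; lia.
  have -> : i = n by lia.
  by rewrite -/g -h0 zh //; lia.
have [_ ->] : _ := zP (j - n) ltac:(lia); lia.
Qed.

Lemma contraction_balanced (H : hypergraph) (S : {set vertex H}) :
  balanced H -> uniformable H -> matching_covered H -> tight_cut S ->
  balanced (contraction S).
Proof.
move=> bal unif cov tight [t [x [e [sc oddt]]]].
(* A cycle has length at least 2, and oddness excludes 2. *)
have t2 : 2 < t.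
  case: sc => -[t1 _ _ _] _; rewrite ltn_neqAle t1 andbT.
  by apply: contraTneq oddt => <-.
have [i0 /eqP xN|xS] := pickP (fun i => x i == None).
  have [X [E [XN _ circ]]] := strong_cycle_circulant i0 sc.
  by apply: contraction_circulant bal unif cov tight oddt t2 circ _; rewrite XN.
have [X [E [_ Xx circ]]] := strong_cycle_circulant (Ordinal (ltnW (ltnW t2))) sc.
have XS j : X j != None by have [i ->] := Xx j; rewrite xS.
have yP j : exists v, X j == Some v.
  by case: (X j) (XS j) => // v _; exists v.
pose y j := xchoose (yP j).
apply: (@balanced_no_circulant H t (fun j => val (y j)) (fun i => val (E i))) => //.
move=> i j it jt; rewrite -mem_contr_Some -circ //.
by rewrite (eqP (xchooseP (yP j))).
Qed.

Theorem theorem3p8 (H : hypergraph) (S : {set vertex H}) :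
  balanced H -> uniformable H -> matching_covered H -> tight_cut S ->
  balanced (contraction S) /\ balanced (contraction (~: S)).
Proof.
move=> bal unif cov tight; split; apply: contraction_balanced => //.
have cutC : cut (~: S) = cut S.
  by apply/setP => e; rewrite !inE setCK andbC.
by move=> M; rewrite cutC; apply: tight.
Qed.
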